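(* Let $X$ be a compact metric space and $\sigma:X\to X$ a piecewise homeomorphism. Then $G_\sigma$ is simple if and only if (1) $\sigma$ is eventually surjective, and (2) for every non-empty compact open subset $V$ of the eventual range $Y$ of $\sigma$, there exists $n\ge0$ such that $\sigma^n(V)=Y$. In particular, if $\sigma$ is eventually surjective and is topologically exact when restricted to its eventual range, then $G_\sigma$ is simple. The converse of this last assertion is true if $X$ is totally disconnected.
   Context: A map $\sigma:X\to X$ is a piecewise homeomorphism if $\sigma$ is continuous and open and $X$ admits a finite partition into clopen sets $X_1,\dots,X_n$ such that $\sigma$ is a homeomorphism from $X_i$ onto $\sigma(X_i)$ for each $i$. The transfer map $\mathcal L:C(X,\mathbb Z)\to C(X,\mathbb Z)$ is $(\mathcal Lf)(x)=\sum_{\sigma(y)=x}f(y)$. For $f,g\in C(X,\mathbb Z)$ put $f\sim g$ if $\mathcal L^nf=\mathcal L^ng$ for some $n\ge0$. $G_\sigma$ is the group of equivalence classes $[f]$ with $[f]+[g]=[f+g]$, ordered by the positive cone $G_\sigma^+=\{[f]\mid f\ge0\}$; it is a dimension group. An order ideal of a dimension group $G$ is a subgroup $J$ such that $a,b\in J$ and $a\le c\le b$ imply $c\in J$; it is positively generated if $J=J^+-J^+$, where $J^+=J\cap G^+$. $G$ is simple if it has no positively generated order ideals other than $\{0\}$ and $G$ (equivalently, every nonzero positive element of $G$ is an order unit). $\sigma$ is eventually surjective if $\sigma^{n+1}(X)=\sigma^n(X)$ for some $n\ge0$; then $\sigma^n(X)$ is called the eventual range of $\sigma$. A continuous map $f:Z\to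 Z$ on a compact metric space is topologically exact if for every non-empty open set $V\subset Z$ there is $n\ge0$ with $f^n(V)=Z$. *)

(* Defs.v *)
From HB Require Import structures.
From mathcomp Require Import all_boot all_order all_algebra.
From mathcomp Require Import all_classical all_reals topology.

Set Implicit Arguments.
Unset Strict Implicit.
Unset Printing Implicit Defensive.

Import Order.TTheory GRing.Theory Num.Theory.
Local Open Scope classical_set_scope.
Local Open Scope ring_scope.
Local Open Scope quotient_scope.

Section PiecewiseHomeomorphism.
Variable X : topologicalType.
Implicit Types (sigma : X -> X) (A : set X).

Definition homeomorphism_onto_image A sigma :=
  {within A, continuous sigma} /\
  exists2 tau : X -> X,
    {within sigma @` A, continuous tau} & forall x, A x -> tau (sigma x) = x.

Definition piecewise_homeomorphism sigma :=
  [/\ continuous sigma,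
      forall U : set X, open U -> open (sigma @` U) &
      exists n (P : 'I_n -> set X),
        [/\ partition [set: 'I_n] P [set: X],
            forall i, clopen (P i) &
            forall i, homeomorphism_onto_image (P i) sigma]].

Lemma piecewise_injective sigma : piecewise_homeomorphism sigma ->
  exists n (P : 'I_n -> set X),
    [/\ partition [set: 'I_n] P [set: X], forall i, clopen (P i) &
        forall i x y, P i x -> P i y -> sigma x = sigma y -> x = y].
Proof.
move=> [_ _ [n [P [pP cP hP]]]]; exists n, P; split=> // i x y Px Py e.
by have [_ [tau _ tauK]] := hP i; rewrite -(tauK _ Px) e tauK.
Qed.

Lemma finite_fiber sigma (x : X) : piecewise_homeomorphism sigma ->
  finite_set (sigma @^-1` [set x]).
Proof.
move=> /piecewise_injective[n [P [[cov _ _] _ inj]]].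
have -> : sigma @^-1` [set x] = \bigcup_(i : 'I_n) (P i `&` sigma @^-1` [set x]).
  by rewrite -setI_bigcupl (_ : \bigcup_i P i = setT) ?setTI// -cov.
apply: bigcup_finite => // i _.
have [->//|/set0P[y [Py yx]]] := eqVneq (P i `&` sigma @^-1` [set x]) set0.
apply: (@sub_finite_set _ _ [set y]) => // z [Pz zx].
by apply: (inj i) => //; rewrite zx -yx.
Qed.

End PiecewiseHomeomorphism.

Definition CZ (X : topologicalType) := continuousType X (discrete_topology int).

HB.instance Definition _ (X : topologicalType) := Choice.on (CZ X).

Section ContinuousIntegerFunctions.
Variable X : topologicalType.
Implicit Types f g : CZ X.

Definition CZ_fun (f : CZ X) : X -> int := f.

Lemma CZ_near f x : \forall y \near x, f y = f x.
Proof.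
by have /discrete_cvg := @cts_fun _ _ f x; apply.
Qed.

Lemma near_continuous (f : X -> int) :
  (forall x, \forall y \near x, f y = f x) ->
  continuous (f : X -> discrete_topology int).
Proof. by move=> H x; apply/discrete_cvg; exact: H. Qed.

Definition CZ_mk (f : X -> int)
  (cf : continuous (f : X -> discrete_topology int)) : CZ X := mkcts cf.

Lemma CZ_add_continuous f g :
  continuous ((fun x => CZ_fun f x + CZ_fun g x) : X -> discrete_topology int).
Proof.
apply: near_continuous => x.
by near=> y; rewrite /CZ_fun; congr (_ + _); near: y; exact: CZ_near.
Unshelve. all: by end_near. Qed.

Lemma CZ_opp_continuous f :
  continuous ((fun x => - CZ_fun f x) : X -> discrete_topology int).
Proof.
apply: near_continuous => x.
by near=> y; rewrite /CZ_fun; congr (- _); near: y; exact: CZ_near.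
Unshelve. all: by end_near. Qed.

Lemma CZ_zero_continuous :
  continuous ((fun=> 0 : int) : X -> discrete_topology int).
Proof. by apply: near_continuous => x; near=> y. Unshelve. all: by end_near. Qed.

Definition CZ_add f g : CZ X := CZ_mk (@CZ_add_continuous f g).
Definition CZ_opp f : CZ X := CZ_mk (@CZ_opp_continuous f).
Definition CZ_zero : CZ X := CZ_mk CZ_zero_continuous.

Lemma CZP f g : (forall x, CZ_fun f x = CZ_fun g x) -> f = g.
Proof. by move=> fg; apply/continuousEP. Qed.

Lemma CZ_addA : associative CZ_add.
Proof. by move=> f g h; apply: CZP => x; exact: addrA. Qed.
Lemma CZ_addC : commutative CZ_add.
Proof. by move=> f g; apply: CZP => x; exact: addrC. Qed.
Lemma CZ_add0 : left_id CZ_zero CZ_add.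
Proof. by move=> f; apply: CZP => x; exact: add0r. Qed.
Lemma CZ_addN : left_inverse CZ_zero CZ_opp CZ_add.
Proof. by move=> f; apply: CZP => x; exact: addNr. Qed.

HB.instance Definition _ :=
  GRing.isZmodule.Build (CZ X) CZ_addA CZ_addC CZ_add0 CZ_addN.

End ContinuousIntegerFunctions.

(* The [\in] sum is 0 by convention over an infinite support; here fibers are
   finite, by [finite_fiber]. *)
Definition transfer_fun (X : topologicalType) (sigma : X -> X) (f : X -> int) :
    X -> int :=
  fun x => \sum_(y \in sigma @^-1` [set x]) f y.

Section DimensionGroup.
Variables (R : realType) (X : metricType R) (sigma : X -> X).
Hypotheses (cX : compact [set: X]) (hs : piecewise_homeomorphism sigma).
Implicit Types f g : CZ X.

Lemma transfer_continuous f :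
  continuous (transfer_fun sigma (CZ_fun f) : X -> discrete_topology int).
Proof.
have [csig osig _] := hs.
have [n [P [[cov triv _] clP inj]]] := piecewise_injective hs.
pose F i x := \sum_(y \in P i `&` sigma @^-1` [set x]) CZ_fun f y.
have sumF x : transfer_fun sigma (CZ_fun f) x = \sum_(i < n) F i x.
  have fx := finite_fiber x hs.
  under eq_bigr do rewrite /F fsbig_mkcondl fsbig_finite//.
  rewrite exchange_big /transfer_fun fsbig_finite//=.
  apply: eq_bigr => y _.
  have [i _ Piy] : cover [set: 'I_n] P y by rewrite cov.
  rewrite (bigD1 i)//= mem_set// big1 ?addr0// => k /eqP ki.
  rewrite memNset// => Pky; apply: ki; apply: triv => //.
  by exists y.
have FE i y : P i y -> F i (sigma y) = CZ_fun f y.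
  move=> Py; rewrite /F (_ : P i `&` _ = [set y]) ?fsbig_set1//.
  by apply/seteqP; split=> [z [Pz /= e]|z ->//]; exact: (inj i).
have F0 i x : ~ (sigma @` P i) x -> F i x = 0.
  move=> nx; rewrite /F (_ : P i `&` _ = set0) ?fsbig_set0//.
  by rewrite -subset0 => y [Py e]; apply: nx; exists y.
have nearF i x : \forall y \near x, F i y = F i x.
  have [[y Py <-]|nx] := pselect ((sigma @` P i) x).
    pose U := P i `&` [set z | f z = f y].
    have oU : open U.
      apply: openI; first exact: (clP i).1.
      rewrite openE => z /= zy; rewrite /interior /=.
      by rewrite -{1}zy; exact: CZ_near.
    have : nbhs (sigma y) (sigma @` U).
      by apply: open_nbhs_nbhs; split; [exact: osig|exists y].
    by apply: filterS => _ [z [Pz fzy] <-]; rewrite !FE.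
  have clo : closed (sigma @` P i).
    apply: compact_closed; first exact: metric_hausdorff.
    apply: continuous_compact; first exact: continuous_subspaceT.
    exact: subclosed_compact (clP i).2 cX _.
  have : nbhs x (~` (sigma @` P i)).
    by apply: open_nbhs_nbhs; split => //; exact: closed_openC.
  by apply: filterS => z nz; rewrite !F0.
apply: near_continuous => x.
have : \forall y \near x, forall i : 'I_n, F i y = F i x.
  by apply: filter_forall => i; exact: nearF.
by apply: filterS => y H; rewrite !sumF; apply: eq_bigr => i _; exact: H.
Qed.

Definition transfer f : CZ X := CZ_mk (@transfer_continuous f).

Lemma transferD f g : transfer (f + g) = transfer f + transfer g.
Proof.
apply: CZP => x.
rewrite [LHS](_ : _ = \sum_(y \in sigma @^-1` [set x])
  (CZ_fun f y + CZ_fun g y))//.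
by rewrite fsbig_split//; exact: finite_fiber.
Qed.

Lemma iter_transferD n f g :
  iter n transfer (f + g) = iter n transfer f + iter n transfer g.
Proof. by elim: n => // n IH; rewrite !iterS IH transferD. Qed.

Lemma iter_transferN n f : iter n transfer (- f) = - iter n transfer f.
Proof.
apply/eqP; rewrite -addr_eq0 -iter_transferD addNr; apply/eqP.
by apply: (@addrI _ (iter n transfer 0)); rewrite -iter_transferD !addr0.
Qed.

Definition transfer_equiv f g : bool :=
  `[< exists n, iter n transfer f = iter n transfer g >].

Lemma iter_transfer_le m n f g : (m <= n)%N ->
  iter m transfer f = iter m transfer g ->
  iter n transfer f = iter n transfer g.
Proof. by move=> /subnK <- e; rewrite !iterD e. Qed.

Lemma transfer_equiv_class : equiv_class_of transfer_equiv.
Proof.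
split=> [f|f g|g f h].
- by apply/asboolP; exists 0%N.
- by apply/asbool_equiv_eq; split=> -[n e]; exists n.
- move=> /asboolP[m fg] /asboolP[n gh]; apply/asboolP; exists (maxn m n).
  by rewrite (iter_transfer_le (leq_maxl m n) fg)
             (iter_transfer_le (leq_maxr m n) gh).
Qed.

Canonical transfer_equiv_equiv := EquivRelPack transfer_equiv_class.
Canonical transfer_equiv_encModRel := defaultEncModRel transfer_equiv.

Definition Gsigma := {eq_quot transfer_equiv}.

HB.instance Definition _ : EqQuotient (CZ X) transfer_equiv Gsigma :=
  EqQuotient.on Gsigma.
HB.instance Definition _ := Choice.on Gsigma.

Definition Gsigma_zero : Gsigma := lift_cst Gsigma 0.
Definition Gsigma_add := lift_op2 Gsigma +%R.
Definition Gsigma_opp := lift_op1 Gsigma -%R.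

Canonical pi_Gsigma_zero_morph := PiConst Gsigma_zero.

Lemma pi_Gsigma_opp : {morph \pi_Gsigma : f / - f >-> Gsigma_opp f}.
Proof.
move=> f; unlock Gsigma_opp; apply/eqP; rewrite piE.
have /eqP := reprK (\pi_Gsigma f); rewrite piE => /asboolP[n e].
by apply/asboolP; exists n; rewrite !iter_transferN e.
Qed.
Canonical pi_Gsigma_opp_morph := PiMorph1 pi_Gsigma_opp.

Lemma pi_Gsigma_add : {morph \pi_Gsigma : f g / f + g >-> Gsigma_add f g}.
Proof.
move=> f g; unlock Gsigma_add; apply/eqP; rewrite piE.
have /eqP := reprK (\pi_Gsigma f); rewrite piE => /asboolP[m em].
have /eqP := reprK (\pi_Gsigma g); rewrite piE => /asboolP[n en].
apply/asboolP; exists (maxn m n); rewrite !iter_transferD.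
by rewrite (iter_transfer_le (leq_maxl m n) em)
           (iter_transfer_le (leq_maxr m n) en).
Qed.
Canonical pi_Gsigma_add_morph := PiMorph2 pi_Gsigma_add.

Lemma Gsigma_addA : associative Gsigma_add.
Proof. by move=> x y z; rewrite -[x]reprK -[y]reprK -[z]reprK !piE addrA. Qed.
Lemma Gsigma_addC : commutative Gsigma_add.
Proof. by move=> x y; rewrite -[x]reprK -[y]reprK !piE addrC. Qed.
Lemma Gsigma_add0 : left_id Gsigma_zero Gsigma_add.
Proof. by move=> x; rewrite -[x]reprK !piE add0r. Qed.
Lemma Gsigma_addN : left_inverse Gsigma_zero Gsigma_opp Gsigma_add.
Proof. by move=> x; rewrite -[x]reprK !piE addNr. Qed.

HB.instance Definition _ := GRing.isZmodule.Build Gsigma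
  Gsigma_addA Gsigma_addC Gsigma_add0 Gsigma_addN.

Definition Gsigma_pos : set Gsigma :=
  [set \pi_Gsigma f | f in [set f : CZ X | forall x, 0 <= CZ_fun f x]].

End DimensionGroup.
Arguments transfer {R X sigma} cX hs f.
Arguments transfer_equiv {R X sigma} cX hs f g.
Arguments Gsigma {R X sigma} cX hs.
Arguments Gsigma_pos {R X sigma} cX hs _.

Section OrderedGroup.
Variables (G : zmodType) (pos : set G).
Implicit Types J : set G.

Definition cone_le (a b : G) := pos (b - a).

Definition subgroup J := J 0 /\ forall a b, J a -> J b -> J (a - b).

Definition order_ideal J :=
  subgroup J /\
  forall a b c, J a -> J b -> cone_le a c -> cone_le c b -> J c.

Definition positively_generated J :=
  J = [set a - b | a in J `&` pos & b in J `&` pos].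

Definition simple_group :=
  forall J, order_ideal J -> positively_generated J ->
    J = [set 0] \/ J = [set: G].

End OrderedGroup.

Section Dynamics.
Variable X : topologicalType.
Implicit Types (sigma : X -> X) (Y Z : set X).

Definition stable_image sigma n :=
  iter n.+1 sigma @` [set: X] = iter n sigma @` [set: X].

Definition eventually_surjective sigma := exists n, stable_image sigma n.

Definition is_eventual_range sigma Y :=
  exists2 n, stable_image sigma n & Y = iter n sigma @` [set: X].

(* [open (V : set (subspace Z))] with [V `<=` Z] is openness relative to Z;
   points outside Z are isolated in [subspace Z], so [V `<=` Z] is needed. *)
Definition topologically_exact_on sigma Z :=
  forall V : set X, V `<=` Z -> V !=set0 -> open (V : set (subspace Z)) ->
    exists n, iter n sigma @` V = Z.

End Dynamics.

(* Main.v *)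
(* Simplicity means that every nonzero positive class [f] is an order unit.  For
   f >= 0 the support of L^n f is the image under sigma^n of the support of f,
   so comparing the class of the indicator of a clopen set V with that of 1
   gives sigma^n(V) = sigma^n(X) for some n.  Hence G_sigma is simple iff every
   nonempty clopen V is spreading in this sense: V = sigma(X) yields eventual
   surjectivity, and the remaining V yield (2).  For the converse, L^n f >= 1 on
   sigma^n(X) dominates L^n h up to a constant, and pointwise positivity of
   L^n h is positivity of [h] because a nonnegative function supported on
   sigma^n(X) lifts through L^n, using a clopen set that sigma maps
   injectively onto the image.  When X is totally disconnected, clopen sets
   form a base since components coincide with quasi-components. *)
Require Import Defs.
From mathcomp Require Import all_boot all_order all_algebra.
From mathcomp Require Import all_classical all_reals topology.

Set Implicit Arguments.
Unset Strict Implicit.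
Unset Printing Implicit Defensive.

Import Order.TTheory GRing.Theory Num.Theory.
Local Open Scope classical_set_scope.
Local Open Scope ring_scope.
Local Open Scope quotient_scope.

(** * Order ideals and order units in a group with a positive cone *)

Section OrderUnits.
Variables (G : zmodType) (pos : set G).
Hypotheses (pos0 : pos 0) (posD : forall a b, pos a -> pos b -> pos (a + b)).

Lemma posMn a n : pos a -> pos (a *+ n).
Proof.
by move=> pa; elim: n => [|n IH]; rewrite ?mulr0n// mulrS; exact: posD.
Qed.

(** Encodes -n a <= c <= n a; for positive [a] this is the order ideal generated by [a]. *)
Definition principal_ideal (a : G) : set G :=
  [set c | exists n, pos (a *+ n - c) /\ pos (a *+ n + c)].

Lemma order_ideal_principal a : pos a -> order_ideal pos (principal_ideal a).
Proof.
move=> pa; split; first split.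
- by exists 0%N; rewrite mulr0n subr0 addr0.
- move=> c d [m [cm1 cm2]] [n [dn1 dn2]]; exists (m + n)%N.
  rewrite mulrnDr opprB; split.
  + by rewrite (addrC d) addrACA; exact: posD.
  + by rewrite addrACA; exact: posD.
move=> b d c [m [bm1 bm2]] [n [dn1 dn2]]; rewrite /cone_le => bc cd.
(* Here -m a <= b <= c <= d <= n a; both bounds on [c] are weakened to m + n by a positive multiple
   of [a]. *)
exists (m + n)%N; rewrite mulrnDr; split.
- rewrite -addrA; apply: posD; first exact: posMn.
  by have := posD dn1 cd; rewrite -addrA [- d + _]addrA addNr add0r.
- rewrite -addrA addrCA; apply: posD; first exact: posMn.
  by have := posD bm2 bc; rewrite -addrA [b + _]addrC subrK.
Qed.

Lemma principal_ideal_id a : pos a -> principal_ideal a a.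
Proof. by move=> pa; exists 1%N; rewrite mulr1n subrr; split=> //; exact: posD. Qed.

(** If -n a <= c, then [c] is the difference of n a + c and n a, both positive and in the ideal. *)
Lemma positively_generated_principal a :
  pos a -> positively_generated pos (principal_ideal a).
Proof.
move=> pa; have [[J0 JB] _] := order_ideal_principal pa.
have JN c : principal_ideal a c -> principal_ideal a (- c).
  by move=> Jc; rewrite -sub0r; exact: JB.
have Jn n : principal_ideal a (a *+ n).
  elim: n => [|n IH]; first by rewrite mulr0n.
  rewrite mulrSr -[X in _ + X]opprK; apply: JB => //.
  by apply: JN; exact: principal_ideal_id.
apply/seteqP; split=> [c Jc|_ [b [Jb _] [d [Jd _] <-]]]; last exact: JB.
have [n [_ n2]] := Jc; exists (a *+ n + c).
  by split=> //; rewrite -[c]opprK; apply: JB => //; exact: JN.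
exists (a *+ n); first by split=> //; exact: posMn.
by rewrite addrC addKr.
Qed.

Lemma simple_order_unit a b : simple_group pos -> pos a -> a <> 0 ->
  exists n, cone_le pos b (a *+ n).
Proof.
move=> sG pa a0; have Ja := principal_ideal_id pa.
have := sG _ (order_ideal_principal pa) (positively_generated_principal pa).
case=> JE; first by rewrite JE in Ja.
have [n [n1 _]] : principal_ideal a b by rewrite JE.
by exists n.
Qed.

(** A nonzero positive [a] in [J] forces J = G by convexity between -n a and n a; without one, J+ =
    0 and so J = J+ - J+ = 0. *)
Lemma order_unit_simple :
  (forall a, pos a -> a <> 0 -> forall b, principal_ideal a b) ->
  simple_group pos.
Proof.
move=> ou J [[J0 JB] Jconv] Jgen.
have JN c : J c -> J (- c) by move=> Jc; rewrite -sub0r; exact: JB.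
have [[a [Ja pa] a0]|nz] := pselect (exists2 a, (J `&` pos) a & a <> 0).
  have Jn n : J (a *+ n).
    elim: n => [|n IH]; first by rewrite mulr0n.
    by rewrite mulrSr -[X in _ + X]opprK; apply: JB => //; exact: JN.
  right; apply/seteqP; split=> // c _; have [n [n1 n2]] := ou _ pa a0 c.
  apply: (Jconv (- (a *+ n)) (a *+ n)) => //; first exact: JN.
  by rewrite /cone_le opprK addrC.
have J0E c : (J `&` pos) c -> c = 0.
  by move=> Jc; apply: contrapT => c0; apply: nz; exists c.
left; apply/seteqP; split=> [c|_ ->//]; rewrite Jgen => -[b /J0E -> [d /J0E ->]].
by rewrite subrr => <-.
Qed.

End OrderUnits.

(** * Locally constant functions, clopen sets and quasi-components *)

Section CompactClopen.
Variable T : topologicalType.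

Lemma CZ_bounded (f : CZ T) : compact [set: T] ->
  exists n : nat, forall x, `|CZ_fun f x| <= n%:Z.
Proof.
move=> /compact_near_coveringP/(_ nat \oo (fun n x => `|CZ_fun f x| <= n%:Z)).
case=> [x _|n _ /(_ n (leqnn n))bf]; last by exists n => x; exact: bf.
exists ([set y | f y = f x], [set n | (`|CZ_fun f x| <= n)%N]).
  by split; [exact: CZ_near|exists `|CZ_fun f x|%N].
by move=> [y n] [/= fyx xn]; rewrite /CZ_fun fyx -abszE lez_nat.
Qed.

Lemma CZ_restrict (f : T -> int) (A : set T) : clopen A ->
    (forall x, A x -> \forall y \near x, f y = f x) ->
  exists g : CZ T, forall x, CZ_fun g x = if `[< A x >] then f x else 0.
Proof.
move=> [oA cA] cf.
have cg : continuous ((fun x => if `[< A x >] then f x else 0) :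
    T -> discrete_topology int).
  apply: near_continuous => x; case: asboolP => [Ax|nAx].
    have : \forall y \near x, A y /\ f y = f x.
      by apply: filterI; [exact: open_nbhs_nbhs|exact: cf].
    by apply: filterS => y [/asboolP -> ->].
  have : \forall y \near x, (~` A) y.
    by apply: open_nbhs_nbhs; split=> //; exact: closed_openC.
  by apply: filterS => y; case: asboolP.
by exists (CZ_mk cg).
Qed.

Lemma CZ_indicator (A : set T) : clopen A ->
  exists g : CZ T, forall x, CZ_fun g x = (`[< A x >])%:Z.
Proof.
move=> clA; have [|g gE] := @CZ_restrict (fun=> 1) A clA.
  by move=> x _; apply: nearW.
by exists g => x; rewrite gE; case: asboolP.
Qed.

Lemma CZ_clopen (f : CZ T) (S : set int) : clopen [set x | S (CZ_fun f x)].
Proof.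
have oS S' : open [set x | S' (CZ_fun f x)].
  rewrite openE => x Sx; rewrite /interior /=.
  by apply: filterS (CZ_near f x) => y e /=; rewrite /CZ_fun e.
by split=> //; rewrite -openC; exact: (oS (~` S)).
Qed.

Definition quasi_component (x : T) : set T :=
  \bigcap_(W in [set W | clopen W /\ W x]) W.

(** The clopen neighbourhoods of [x] are closed under finite intersection, and every point of the
    compact complement of [O] is missed by one of them; by compactness a single one misses that
    complement. *)
Lemma clopen_in_open (x : T) (O : set T) : compact [set: T] -> open O ->
  quasi_component x `<=` O -> exists W, [/\ clopen W, W x & W `<=` O].
Proof.
move=> cT oO QO; pose F := filter_from [set W | clopen W /\ W x] id.
have FF : Filter F.
  apply: filter_from_filter; first by exists setT; split=> //; exact: clopenT.
  by move=> A B [? ?] [? ?]; exists (A `&` B) => //; split=> //; exact: clopenI.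
have PF : ProperFilter F by apply: filter_from_proper => W [_ Wx]; exists x.
have /compact_near_coveringP : compact (~` O).
  by apply: (subclosed_compact _ cT) => //; exact: open_closedC.
move=> /(_ _ _ setC (powerset_filter_from_filter PF))[].
  move=> y nOy; have [W [clW Wx] nWy] : exists2 W, clopen W /\ W x & ~ W y.
    by apply: contrapT => H; apply/nOy/QO => W clW; apply: contrapT => nW;
      apply: H; exists W.
  exists (~` W, [set U | U `<=` W]); first split.
  - by apply: open_nbhs_nbhs; split=> //; exact: closed_openC clW.2.
  - apply/near_powerset_filter_fromP; first by move=> ? ?; exact: subset_trans.
    by exists W => //; exists W.
  - by case=> i j [? /subsetC]; apply.
move=> D [DF _ [C DC]] /(_ _ DC)/subsetC2 CO.
by have [W [clW Wx] WC] := DF _ DC; exists W; split=> //; exact: subset_trans CO.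
Qed.

Lemma closed_quasi_component x : closed (quasi_component x).
Proof. by apply: closed_bigI => W [[]]. Qed.

(* Separate A and B by disjoint open sets; a clopen neighbourhood of x inside
   their union meets the first one in a clopen set, which contains the
   quasi-component. *)
Lemma quasi_component_disconnection x (A B : set T) :
    hausdorff_space T -> compact [set: T] -> closed A -> closed B ->
    A `&` B = set0 -> quasi_component x = A `|` B -> A x ->
  quasi_component x = A.
Proof.
move=> hT cT cA cB AB QE Ax.
have nA : set_nbhs A (~` B).
  apply/set_nbhsP; exists (~` B); split=> //; first exact: closed_openC.
  by apply/disjoints_subset.
have [U0 /set_nbhsP[U [oU AU UU0]] clU0] := compact_normal hT cT cA nA.
have clU : closure U `<=` ~` B by apply: subset_trans clU0; exact: closureS.
have [||W [[oW cW] Wx WUV]] := @clopen_in_open x (U `|` ~` closure U) cT.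
- by apply: openU => //; exact/closed_openC/closed_closure.
- by rewrite QE => y [/AU|By]; [left|right=> /clU].
have WE : W `&` U = W `&` closure U.
  apply/seteqP; split=> y [Wy Uy]; split=> //; first exact: subset_closure.
  by have [] := WUV _ Wy.
have QWU : quasi_component x `<=` W `&` U.
  apply: bigcap_inf; split; last by split=> //; exact: AU.
  by split; [exact: openI|rewrite WE; apply: closedI => //; exact: closed_closure].
rewrite QE; apply/seteqP; split=> [y|]; last exact: subsetUl.
move=> [//|By]; have [_ Uy] := QWU y ltac:(by rewrite QE; right).
by have := clU y (subset_closure Uy).
Qed.

(** A relatively clopen [B] and its complement in the quasi-component are disjoint closed sets. The
    one containing [x] is everything, and it cannot be the complement because [B] has a point. *)
Lemma quasi_component_connected x :
  hausdorff_space T -> compact [set: T] -> connected (quasi_component x).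
Proof.
move=> hT cT B [b Bb] [C oC BC] [D cD BD].
have cQ : closed (quasi_component x) by exact: closed_quasi_component.
have cB : closed B by rewrite BD; exact: closedI.
have cB' : closed (quasi_component x `&` ~` C).
  by apply: closedI => //; exact: open_closedC.
have dis : B `&` (quasi_component x `&` ~` C) = set0.
  by rewrite BC -subset0 => y [[_ Cy] [_]].
have QE : quasi_component x = B `|` (quasi_component x `&` ~` C).
  by rewrite BC -setIUr setUv setIT.
have Qx : quasi_component x x by move=> W [].
have [Bx|[_ Cx]] : (B `|` (quasi_component x `&` ~` C)) x by rewrite -QE.
  by apply/esym; exact: quasi_component_disconnection cB' dis QE Bx.
rewrite setUC in QE; rewrite setIC in dis.
have := quasi_component_disconnection hT cT cB' cB dis QE (conj Qx Cx).
move: (Bb); rewrite BC => -[Qb Cb] /seteqP[/(_ b Qb)].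
by case.
Qed.

Lemma totally_disconnected_clopen (x : T) (O : set T) :
    hausdorff_space T -> compact [set: T] -> totally_disconnected [set: T] ->
  open O -> O x -> exists W, [/\ clopen W, W x & W `<=` O].
Proof.
move=> hT cT tdT oO Ox; apply: clopen_in_open => // y Qy.
suff -> : y = x by [].
have : connected_component [set: T] x y.
  exists (quasi_component x) => //; split=> //; first by move=> W [].
  exact: quasi_component_connected.
by rewrite tdT.
Qed.

End CompactClopen.

(** * Images under iterates *)

Section IterImage.
Variables (T : Type) (f : T -> T).

Lemma iterS_image n (A : set T) :
  iter n.+1 f @` A = f @` (iter n f @` A).
Proof. by rewrite image_comp. Qed.

Lemma iterD_image m n (A : set T) :
  iter (m + n) f @` A = iter m f @` (iter n f @` A).
Proof. by rewrite image_comp; apply: eq_imagel => x _; rewrite iterD. Qed.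

Lemma iter_image_stable n m : (n <= m)%N ->
    iter n.+1 f @` [set: T] = iter n f @` [set: T] ->
  iter m f @` [set: T] = iter n f @` [set: T].
Proof.
move=> /subnK <- e; elim: (m - n)%N => // k IH.
by rewrite addSn iterS_image IH -iterS_image.
Qed.

Lemma iter_image_le m k (A B : set T) : (m <= k)%N ->
  iter m f @` A = iter m f @` B -> iter k f @` A = iter k f @` B.
Proof. by move=> /subnK <- e; rewrite !iterD_image e. Qed.

End IterImage.

(** * Supports and lifts under the transfer map *)

Section Transfer.
Variables (R : realType) (X : metricType R) (sigma : X -> X).
Hypotheses (cX : compact [set: X]) (hs : piecewise_homeomorphism sigma).
Implicit Types (f g k : CZ X) (A : set X).
Let L := transfer cX hs.

Lemma clopen_image A : clopen A -> clopen (sigma @` A).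
Proof.
have [csig osig _] := hs; move=> [oA cA]; split; first exact: osig.
apply: compact_closed; first exact: metric_hausdorff.
apply: continuous_compact; first exact: continuous_subspaceT.
exact: subclosed_compact cA cX _.
Qed.

Lemma clopen_iter_image n A : clopen A -> clopen (iter n sigma @` A).
Proof.
move=> clA; elim: n => [|n IH]; first by rewrite image_id.
by rewrite iterS_image; exact: clopen_image.
Qed.

Lemma iter_transfer_ge0 n f : (forall x, 0 <= CZ_fun f x) ->
  forall x, 0 <= CZ_fun (iter n L f) x.
Proof. by elim: n => // n IH f0 x; apply: fsumr_ge0 => y _; exact: IH. Qed.

(** A finite sum of nonnegative terms over a fiber is positive exactly when one term is. *)
Lemma transfer_gt0 f : (forall x, 0 <= CZ_fun f x) ->
  [set x | 0 < CZ_fun (L f) x] = sigma @` [set y | 0 < CZ_fun f y].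
Proof.
move=> f0; apply/seteqP; split=> [x|_ [y fy <-]] /=.
  by move=> /fsumr_gt0-/(_ [::])[y /= yx fy]; exists y.
rewrite lt0r (@iter_transfer_ge0 1)// andbT; apply/eqP => s0.
suff e : CZ_fun f y = 0 by rewrite /= e in fy.
apply: (pfsumr_eq0 _ _ s0) => //; first exact: finite_fiber.
Qed.

Lemma iter_transfer_gt0 n f : (forall x, 0 <= CZ_fun f x) ->
  [set x | 0 < CZ_fun (iter n L f) x] =
    iter n sigma @` [set y | 0 < CZ_fun f y].
Proof.
move=> f0; elim: n => [|n IH]; first by rewrite image_id.
rewrite [iter _ _ _]iterS transfer_gt0; last exact: iter_transfer_ge0.
by rewrite IH -iterS_image.
Qed.

Lemma iter_transfer_support n f A : (forall x, ~ A x -> CZ_fun f x = 0) ->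
  forall x, ~ (iter n sigma @` A) x -> CZ_fun (iter n L f) x = 0.
Proof.
move=> fA; elim: n => [|n IH] x nx; first by apply: fA; rewrite image_id in nx.
apply: fsbig1 => y yx; apply: IH => Ay; apply: nx.
by rewrite iterS_image; exists y.
Qed.

(** Chooses one preimage in [A] for each point of sigma(A), so that functions can be lifted through
    [L]. *)
Lemma clopen_section A : clopen A -> exists C, [/\ clopen C, C `<=` A,
  forall x y, C x -> C y -> sigma x = sigma y -> x = y &
  sigma @` C = sigma @` A].
Proof.
move=> clA; have [csig _ _] := hs.
have [n [P [[cov _ _] clP inj]]] := piecewise_injective hs.
(* The image condition is restated piece by piece, to allow induction on the list of pieces. *)
suff [C [clC CA injC sC]] : exists C, [/\ clopen C, C `<=` A,
    forall x y, C x -> C y -> sigma x = sigma y -> x = y &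
    forall i, i \in enum 'I_n -> sigma @` (A `&` P i) `<=` sigma @` C].
  exists C; split=> //; apply/seteqP; split; first exact: image_subset.
  move=> _ [y Ay <-]; have [i _ Piy] : cover [set: 'I_n] P y by rewrite cov.
  by apply: (sC i); [rewrite mem_enum|exists y].
(* Add the pieces one at a time, keeping in each only the points whose image
   is not reached yet. *)
elim: (enum _) => [|i s [C [clC CA injC sC]]].
  by exists set0; split=> //; exact: clopen0.
pose D := A `&` P i `&` ~` (sigma @^-1` (sigma @` C)).
have nCD x y : C x -> D y -> sigma x <> sigma y.
  by move=> Cx [_ nDy] e; apply: nDy; exists x.
exists (C `|` D); split.
- apply: clopenU => //; apply: clopenI; first exact: clopenI.
  by apply: clopenC => //; apply: preimage_clopen => //; exact: clopen_image.
- by move=> x [/CA//|[[]]].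
- move=> x y [Cx|Dx] [Cy|Dy] e; first exact: injC.
  + by case: (nCD x y).
  + by case: (nCD y x).
  + by apply: (inj i) => //; [case: Dx => -[]|case: Dy => -[]].
- move=> j; rewrite inE => /orP[/eqP ->|js]; last first.
    by apply: (subset_trans (sC j js)); apply: image_subset; exact: subsetUl.
  move=> _ [y Ay <-]; have [[z Cz zy]|ny] := pselect ((sigma @` C) (sigma y)).
    by exists z => //; left.
  by exists y => //; right.
Qed.

(** Take k o sigma on a section [C] of [A] and 0 elsewhere: a fiber over sigma(A) meets [C] in one
    point, and the other fibers miss [C]. Support in [A] is recorded so that lifting can be
    iterated. *)
Lemma transfer_lift A k : clopen A -> (forall x, 0 <= CZ_fun k x) ->
    (forall x, ~ (sigma @` A) x -> CZ_fun k x = 0) ->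
  exists g, [/\ forall x, 0 <= CZ_fun g x,
    forall x, ~ A x -> CZ_fun g x = 0 & L g = k].
Proof.
move=> clA k0 kA; have [csig _ _] := hs.
have [C [clC CA injC sC]] := clopen_section clA.
have [g gE] : exists g : CZ X, forall x,
    CZ_fun g x = if `[< C x >] then CZ_fun k (sigma x) else 0.
  apply: (@CZ_restrict _ (CZ_fun k \o sigma)) => // x _.
  exact: (csig x _ (CZ_near k (sigma x))).
exists g; split=> [x|x nAx|].
- by rewrite gE; case: ifP.
- by rewrite gE; case: asboolP => // /CA.
apply: CZP => x; rewrite -[LHS]/(transfer_fun sigma (CZ_fun g) x) /transfer_fun.
have [[c Cc cx]|nCx] := pselect ((sigma @` C) x).
  rewrite -(@fsbig_widen _ _ _ _ [set c]).
  - by rewrite fsbig_set1 gE asboolT// cx.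
  - by move=> _ ->.
  - move=> y [/= yx yc]; rewrite gE; case: asboolP => // Cy.
    by case: yc; apply: injC => //; rewrite yx.
rewrite kA -?sC// fsbig1// => y /= yx; rewrite gE; case: asboolP => // Cy.
by case: nCx; exists y.
Qed.

Lemma iter_transfer_lift n A k : clopen A -> (forall x, 0 <= CZ_fun k x) ->
    (forall x, ~ (iter n sigma @` A) x -> CZ_fun k x = 0) ->
  exists2 g, forall x, 0 <= CZ_fun g x & iter n L g = k.
Proof.
move=> clA; elim: n k => [|n IH] k k0 kA; first by exists k.
have [|g1 [g10 g1A <-]] := transfer_lift (clopen_iter_image n clA) k0.
  by move=> x; rewrite -iterS_image; exact: kA.
by have [g g0 <-] := IH g1 g10 g1A; exists g.
Qed.

(** * The group and its positive cone in terms of representatives *)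

Lemma Gsigma_piP f g : \pi_(Gsigma cX hs) f = \pi_(Gsigma cX hs) g <->
  exists n, iter n L f = iter n L g.
Proof.
split=> [/eqP|[n e]]; first by rewrite piE => /asboolP.
by apply/eqP; rewrite piE; apply/asboolP; exists n.
Qed.

(** If L^n f >= 0, it is supported on sigma^n(X), hence equals L^n g for some g >= 0, a nonnegative
    representative of the class. *)
Lemma Gsigma_posP f : Gsigma_pos cX hs (\pi_(Gsigma cX hs) f) <->
  exists n, forall x, 0 <= CZ_fun (iter n L f) x.
Proof.
split=> [[g g0 /Gsigma_piP[n e]]|[n fn0]].
  by exists n => x; rewrite -e; exact: iter_transfer_ge0.
have [|g g0 e] := @iter_transfer_lift n setT (iter n L f) clopenT fn0.
  by apply: iter_transfer_support => x /(_ I).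
by exists g => //; apply/Gsigma_piP; exists n.
Qed.

Lemma Gsigma_pi_surj (a : Gsigma cX hs) :
  exists f, a = \pi_(Gsigma cX hs) f.
Proof. by exists (repr a); rewrite reprK. Qed.

Lemma Gsigma_pi0 : \pi_(Gsigma cX hs) 0 = 0.
Proof. by rewrite piE. Qed.

Lemma Gsigma_piD f g : \pi_(Gsigma cX hs) (f + g) =
  \pi_(Gsigma cX hs) f + \pi_(Gsigma cX hs) g.
Proof. by rewrite [RHS]piE. Qed.

Lemma Gsigma_piB f g : \pi_(Gsigma cX hs) (f - g) =
  \pi_(Gsigma cX hs) f - \pi_(Gsigma cX hs) g.
Proof. by rewrite [RHS]piE. Qed.

Lemma Gsigma_piMn f n : \pi_(Gsigma cX hs) (f *+ n) =
  \pi_(Gsigma cX hs) f *+ n.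
Proof.
elim: n => [|n IH]; first by rewrite !mulr0n Gsigma_pi0.
by rewrite !mulrS Gsigma_piD IH.
Qed.

Lemma Gsigma_pos0 : Gsigma_pos cX hs 0.
Proof. by rewrite -Gsigma_pi0; exists 0. Qed.

Lemma Gsigma_posD (a b : Gsigma cX hs) : Gsigma_pos cX hs a ->
  Gsigma_pos cX hs b -> Gsigma_pos cX hs (a + b).
Proof.
move=> [f f0 <-] [g g0 <-]; exists (f + g); last exact: Gsigma_piD.
by move=> x; apply: addr_ge0; [exact: f0|exact: g0].
Qed.

(** * Simplicity of the group as spreading of clopen sets *)

Lemma iter_transferMn n f m : iter n L (f *+ m) = iter n L f *+ m.
Proof.
elim: m => [|m IH]; last by rewrite !mulrS iter_transferD IH.
by rewrite !mulr0n; apply: (@addrI _ (iter n L 0)); rewrite -iter_transferD !addr0.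
Qed.

Lemma CZ_funMn f m x : CZ_fun (f *+ m) x = CZ_fun f x *+ m.
Proof. by elim: m => // m IH; rewrite !mulrS -IH. Qed.

Lemma Gsigma_pi_neq0 f x : (forall x, 0 <= CZ_fun f x) -> 0 < CZ_fun f x ->
  \pi_(Gsigma cX hs) f <> 0.
Proof.
move=> f0 fx; rewrite -Gsigma_pi0 => /Gsigma_piP[n e].
have : [set y | 0 < CZ_fun (iter n L f) y] (iter n sigma x).
  by rewrite iter_transfer_gt0//; exists x.
by rewrite e iter_transfer_gt0// => -[y /=]; rewrite ltxx.
Qed.

(** The target is sigma^n(X) rather than the eventual range, so eventual surjectivity is not
    presupposed. *)
Definition spreading := forall V : set X, clopen V -> V !=set0 ->
  exists n, iter n sigma @` V = iter n sigma @` [set: X].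

(** The class of the indicator of [V] is an order unit, so L^n 1 <= k L^n 1_V for some k and n;
    comparing supports gives sigma^n(X) inside sigma^n(V). *)
Lemma simple_spreading : simple_group (Gsigma_pos cX hs) -> spreading.
Proof.
move=> sG V clV [v Vv]; have [f fE] := CZ_indicator clV.
have [g gE] := @CZ_indicator X _ clopenT.
have f0 x : 0 <= CZ_fun f x by rewrite fE.
have g0 x : 0 <= CZ_fun g x by rewrite gE.
have fgt0 : [set x | 0 < CZ_fun f x] = V.
  by apply/seteqP; split=> x /=; rewrite fE; case: asboolP.
have ggt0 : [set x | 0 < CZ_fun g x] = setT.
  by apply/seteqP; split=> x //= _; rewrite gE asboolT.
have pa : Gsigma_pos cX hs (\pi_(Gsigma cX hs) f) by exists f.
have a0 : \pi_(Gsigma cX hs) f <> 0.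
  by apply: (@Gsigma_pi_neq0 f v) => //; rewrite fE asboolT.
have [k] := simple_order_unit Gsigma_pos0 Gsigma_posD
  (\pi_(Gsigma cX hs) g) sG pa a0.
rewrite /cone_le -Gsigma_piMn -Gsigma_piB => /Gsigma_posP[n kn].
exists n; rewrite -fgt0 -ggt0 -!iter_transfer_gt0//; apply/seteqP; split.
  by rewrite !iter_transfer_gt0// fgt0 ggt0; exact: image_subset.
move=> x /= gx; have := kn x; rewrite iter_transferD iter_transferN iter_transferMn.
rewrite [X in 0 <= X](_ : _ = CZ_fun (iter n L f *+ k) x - CZ_fun (iter n L g) x)//.
rewrite CZ_funMn subr_ge0 => /(lt_le_trans gx).
(* For k = 0 the bound would read 0 < 0. *)
by case: k {kn} => [|k]; rewrite ?mulr0n ?ltxx// pmulrn_lgt0.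
Qed.

Lemma spreading_simple : spreading -> simple_group (Gsigma_pos cX hs).
Proof.
move=> sp; apply: order_unit_simple => _ [f f0 <-] a0 b.
have [h ->] := Gsigma_pi_surj b.
have [v fv] : [set x | 0 < CZ_fun f x] !=set0.
  apply: contrapT => H; apply: a0; rewrite -Gsigma_pi0; congr \pi.
  apply: CZP => x; apply/eqP; rewrite eq_le f0 andbT leNgt; apply/negP => fx.
  by apply: H; exists x.
have [n En] := sp _ (CZ_clopen f [set z | 0 < z]) (ex_intro _ v fv).
have [N bN] := CZ_bounded (iter n L h) cX.
(* Off sigma^n(X) the left side vanishes; on it L^n f is a positive integer, hence at least 1. The
   absolute value serves both signs in [principal_ideal]. *)
have fN x : `|CZ_fun (iter n L h) x| <= CZ_fun (iter n L f) x *+ N.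
  have [xX|nX] := pselect ((iter n sigma @` [set: X]) x); last first.
    rewrite (@iter_transfer_support n h setT) ?normr0//; last by move=> ? /(_ I).
    by apply: mulrn_wge0; exact: iter_transfer_ge0.
  have : [set x | 0 < CZ_fun (iter n L f) x] x by rewrite iter_transfer_gt0// En.
  rewrite /= gtz0_ge1 => f1; apply: (le_trans (bN x)).
  by rewrite -natz lerMn2r f1 orbT.
exists N; rewrite -Gsigma_piMn -Gsigma_piB -Gsigma_piD.
split; apply/Gsigma_posP; exists n => x.
- rewrite iter_transferD iter_transferN iter_transferMn.
  rewrite [X in 0 <= X](_ : _ = CZ_fun (iter n L f *+ N) x - CZ_fun (iter n L h) x)//.
  by rewrite CZ_funMn subr_ge0; apply: le_trans (fN x); exact: ler_norm.
- rewrite iter_transferD iter_transferMn.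
  rewrite [X in 0 <= X](_ : _ = CZ_fun (iter n L f *+ N) x + CZ_fun (iter n L h) x)//.
  rewrite CZ_funMn -[X in _ + X]opprK subr_ge0; apply: le_trans (fN x).
  by rewrite -normrN; exact: ler_norm.
Qed.

End Transfer.

(** * Spreading and the eventual range *)

Section Spreading.
Variables (R : realType) (X : metricType R) (sigma : X -> X).
Hypotheses (cX : compact [set: X]) (hs : piecewise_homeomorphism sigma).

Lemma spreading_eventually_surjective :
  spreading sigma -> eventually_surjective sigma.
Proof.
(* Spreading speaks only of nonempty sets, so the empty space is treated apart. *)
move=> sp; have [[x _]|X0] := pselect ([set: X] !=set0).
  have [||n En] := sp (sigma @` setT).
  - exact: clopen_image clopenT.
  - by exists (sigma x), x.
  by exists n; rewrite /stable_image -addn1 iterD_image.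
by exists 0%N; apply/seteqP; split=> x; case: X0; exists x.
Qed.

(** Y = sigma^n(X) is itself open in X. *)
Lemma eventual_range_open Y V : is_eventual_range sigma Y -> V `<=` Y ->
  open (V : set (subspace Y)) -> open V.
Proof.
move=> [n _ YE] VY /open_subspaceP[W oW WV].
rewrite -(setIidl VY) -WV; apply: openI => //.
by rewrite YE; have [] := clopen_iter_image cX hs n clopenT.
Qed.

(** [V] need not be clopen: its images lie between those of [W] and of X, and agree with [Y] from
    time [maxn m n] on. *)
Lemma spreading_onto Y V W : spreading sigma -> is_eventual_range sigma Y ->
    clopen W -> W !=set0 -> W `<=` V ->
  exists n, iter n sigma @` V = Y.
Proof.
move=> sp [n sn ->] clW W0 WV; have [m Em] := sp W clW W0.
have Vm : iter m sigma @` V = iter m sigma @` setT.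
  by apply/seteqP; split; [exact: image_subset|rewrite -Em; exact: image_subset].
exists (maxn m n); rewrite (iter_image_le (leq_maxl m n) Vm).
exact: iter_image_stable (leq_maxr m n) sn.
Qed.

(** A clopen [V] is first pushed into [Y] by sigma^N, where its image is compact and open; stability
    identifies [Y] with sigma^(n+N)(X). *)
Lemma onto_spreading Y : is_eventual_range sigma Y ->
    (forall V : set X, V `<=` Y -> V !=set0 -> compact V ->
       open (V : set (subspace Y)) -> exists n, iter n sigma @` V = Y) ->
  spreading sigma.
Proof.
move=> [N sN YE] ontoY V clV [v Vv].
have [oV cV] := clopen_iter_image cX hs N clV.
have [||||n En] := ontoY (iter N sigma @` V).
- by rewrite YE; exact: image_subset.
- by exists (iter N sigma v), v.
- exact: subclosed_compact cV cX _.
- exact: open_subspaceW.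
exists (n + N)%N; rewrite iterD_image En YE.
by rewrite (iter_image_stable (leq_addl n N) sN).
Qed.

End Spreading.

Theorem theorem5p3 (R : realType) (X : metricType R) (cX : compact [set: X])
    (sigma : X -> X) (hs : piecewise_homeomorphism sigma) :
  [/\ simple_group (Gsigma_pos cX hs) <->
        eventually_surjective sigma /\
        (forall Y : set X, is_eventual_range sigma Y ->
           forall V : set X, V `<=` Y -> V !=set0 -> compact V ->
             open (V : set (subspace Y)) ->
             exists n : nat, iter n sigma @` V = Y),
      eventually_surjective sigma /\
        (forall Y : set X, is_eventual_range sigma Y ->
           topologically_exact_on sigma Y) ->
        simple_group (Gsigma_pos cX hs) &
      totally_disconnected [set: X] ->
        simple_group (Gsigma_pos cX hs) ->
        eventually_surjective sigma /\
        (forall Y : set X, is_eventual_range sigma Y ->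
           topologically_exact_on sigma Y)].
Proof.
have hX : hausdorff_space X by exact: metric_hausdorff.
have onto_simple : eventually_surjective sigma ->
    (forall Y : set X, is_eventual_range sigma Y ->
       forall V : set X, V `<=` Y -> V !=set0 -> compact V ->
         open (V : set (subspace Y)) -> exists n, iter n sigma @` V = Y) ->
    simple_group (Gsigma_pos cX hs).
  move=> [n sn] ontoY; apply: spreading_simple.
  have rY : is_eventual_range sigma (iter n sigma @` setT) by exists n.
  exact (onto_spreading cX hs rY (ontoY _ rY)).
split.
- split=> [sG|[]//]; have sp := simple_spreading sG.
  split; first exact (spreading_eventually_surjective cX hs sp).
  (* [V] is clopen in X: compact, hence closed, and open in the open set [Y]. *)
  move=> Y rY V VY V0 cV oV; apply: (spreading_onto sp rY _ V0 (@subset_refl _ V)).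
  split; last exact: compact_closed.
  exact (eventual_range_open cX hs rY VY oV).
- by move=> [es ex]; apply: onto_simple => // Y rY V VY V0 _; exact: ex.
- move=> tdX sG; have sp := simple_spreading sG.
  split; first exact (spreading_eventually_surjective cX hs sp).
  move=> Y rY V VY [v Vv] oV.
  (* [V] may fail to be closed, so a clopen neighbourhood of [v] inside it spreads in its place. *)
  have [W [clW Wv WV]] := totally_disconnected_clopen hX cX tdX
    (eventual_range_open cX hs rY VY oV) Vv.
  by apply: (spreading_onto sp rY clW _ WV); exists v.
Qed.
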